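(* Let $g\in L_2(\mathbb{R}_+)$ be a given function. The second kind integral equation with the Stieltjes kernel $$f(x)+\frac1\pi\int_0^\infty\frac{f(t)}{x+t}\,dt=g(x),\quad x>0,\qquad(A)$$ has a unique solution $f\in L_2(\mathbb{R}_+)$, given by the formula $$f(x)=g(x)-\frac2{\pi^2}\int_0^\infty\frac{\sqrt{xt}\,[\log x-\log t]}{x^2-t^2}\,g(t)\,dt.\qquad(B)$$ Conversely, for a given $f\in L_2(\mathbb{R}_+)$, the integral equation (B) in the unknown $g$ has a unique solution $g\in L_2(\mathbb{R}_+)$, given by formula (A).
   Context: $\mathbb{R}_+=(0,\infty)$. Equalities between $L_2$ functions are understood almost everywhere. *)

(* Defs.v *)
From HB Require Import structures.
From mathcomp Require Import all_boot all_order all_algebra.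
From mathcomp Require Import all_classical all_reals all_analysis.
From mathcomp Require Import complex.

Set Implicit Arguments.
Unset Strict Implicit.
Unset Printing Implicit Defensive.

Import Order.TTheory GRing.Theory Num.Theory.
Import numFieldNormedType.Exports.

Local Open Scope classical_set_scope.
Local Open Scope ring_scope.
Local Open Scope complex_scope.

(* Functions on R_+ are represented by total functions R -> R[i] whose values
   outside R_+ are never used.  They are complex-valued; the real-valued
   statements are a special case, as both kernels below are real. *)
Definition Rpos (R : realType) : set R := `]0, +oo[%classic.

Definition ae_eq_Rpos (R : realType) (f g : R -> R[i]) : Prop :=
  ae_eq (@lebesgue_measure R) (@Rpos R) f g.

(* A complex function is measurable when its real and imaginary parts are. *)
Definition L2_Rpos (R : realType) (f : R -> R[i]) : Prop :=
  [/\ measurable_fun (@Rpos R) (fun x => complex.Re (f x)),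
      measurable_fun (@Rpos R) (fun x => complex.Im (f x)) &
      (\int[@lebesgue_measure R]_(x in @Rpos R)
          (Normc.normc (f x) ^+ 2)%:E < +oo)%E].

(* The real-valued Lebesgue integral is a total operation, but for f in
   L_2(R_+) the integrals occurring below converge absolutely for every
   x > 0: both kernels are in L_2(R_+) as functions of t (Cauchy-Schwarz). *)
Definition Cintegral_Rpos (R : realType) (f : R -> R[i]) : R[i] :=
  (\int[@lebesgue_measure R]_(t in @Rpos R) complex.Re (f t)) +i*
  (\int[@lebesgue_measure R]_(t in @Rpos R) complex.Im (f t)).

Definition stieltjes_op (R : realType) (f : R -> R[i]) (x : R) : R[i] :=
  f x + (1 / pi)%:C * Cintegral_Rpos (fun t => f t / (x + t)%:C).

(* At t = x the quotient is 0 / 0 = 0 here; a single point is negligible. *)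
Definition log_kernel (R : realType) (x t : R) : R :=
  Num.sqrt (x * t) * (ln x - ln t) / (x ^+ 2 - t ^+ 2).

Definition log_op (R : realType) (g : R -> R[i]) (x : R) : R[i] :=
  g x - (2 / pi ^+ 2)%:C *
        Cintegral_Rpos (fun t => (log_kernel x t)%:C * g t).

(* Main.v *)
Require Import Defs.
From HB Require Import structures.
From mathcomp Require Import all_boot all_order all_algebra.
From mathcomp Require Import all_classical all_reals all_analysis.
From mathcomp Require Import complex measurable_realfun ring lra.

(** Let S and K be the integral operators on L_2(R_+) with kernels
      s(x,t) = 1 / (pi (x + t)),
      k(x,t) = (2 / pi^2) sqrt(x t) (ln x - ln t) / (x^2 - t^2).
    The two equations read (I + S) f = g and f = (I - K) g, so everything
    follows once I + S and I - K are known to be inverse to each other, that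
    is, once S K = K S = S - K.  (The Mellin transform turns S and K into
    multiplication by 1 / cosh(pi xi) and 1 / (1 + cosh(pi xi)), which is where
    the identity comes from; the proof below stays with the kernels.)

    For kernels the identity says that the integral over r > 0 of
    s(x,r) k(r,t) is s(x,t) - k(x,t) for x <> t; this is
    [integral_stieltjes_log_kernel].  It is elementary because
      ln x - ln t = (x - t) * (integral over y > 0 of 1 / ((x + y)(y + t))):
    substituting this for the logarithm in k(r,t) and exchanging the integrals
    leaves, first in r and then in y, integrands that are rational in the
    square root of the variable, with explicit primitives.  Since k is
    symmetric, the same identity serves for K S.

    All integrands in it are nonnegative, so it also shows 0 <= k <= s.  Hence
    s, k and s - k are nonnegative and bounded by a multiple of 1 / (x + t).
    For such kernels ([stieltjes_dominated]) the Schur test with weight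
    t^(-1/2), for which the integral of t^(-1/2) / (x + t) is pi x^(-1/2), gives
    boundedness on L_2 ([L2real_kernel_op]), and Tonelli's theorem turns the
    kernel identity into S K = K S = S - K ([kernel_op_comp]).  The inverse
    formulas then hold at every x > 0 ([log_opK], [stieltjes_opK]).  Complex
    functions are treated through their real and imaginary parts, the kernels
    being real.  Uniqueness holds because each operator has a left inverse and
    the operators depend only on almost-everywhere classes. *)

Set Implicit Arguments.
Unset Strict Implicit.
Unset Printing Implicit Defensive.

Import Order.TTheory GRing.Theory Num.Theory.
Import numFieldNormedType.Exports.

Local Open Scope classical_set_scope.
Local Open Scope ring_scope.

(** * Integration over the half-line by primitives *)

Lemma RposE (R : realType) (x : R) : @Rpos R x = (0 < x).
Proof. by rewrite /Rpos /= in_itv /= andbT. Qed.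

Lemma measurable_Rpos (R : realType) : measurable (@Rpos R).
Proof. exact: measurable_itv. Qed.
Lemma open_Rpos (R : realType) : open (@Rpos R).
Proof. exact: interval_open. Qed.

#[local] Hint Extern 0 (measurable (@Rpos _)) => solve [apply: measurable_Rpos] : core.

(** The integrand may blow up at 0: the integrals over [1/n, +oo[ are computed
    first, then n tends to infinity by monotone convergence. *)
Lemma ge0_integral_Rpos_FTC (R : realType) (f F : R -> R) (a b : R) :
  (forall x, 0 < x -> 0 <= f x) ->
  (forall x, 0 < x -> {for x, continuous f}) ->
  (forall x : R, 0 < x -> is_derive x 1 F (f x)) ->
  F x @[x --> 0^'+] --> a -> F x @[x --> +oo] --> b ->
  (\int[lebesgue_measure]_(x in @Rpos R) (f x)%:E = (b - a)%:E)%E.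
Proof.
move=> f0 cf dF Fa Fb.
pose e n : R := n.+1%:R^-1.
have e0 n : 0 < e n by rewrite invr_gt0.
have He n : (\int[lebesgue_measure]_(x in `[e n, +oo[) (f x)%:E = (b - F (e n))%:E)%E.
  rewrite (ge0_continuous_FTC2y (F := F) (l := b)) //.
  - by move=> x ex; apply/f0/(lt_le_trans (e0 n)).
  - apply: continuous_in_subspaceT => x; rewrite inE /= in_itv /= andbT => ex.
    exact/cf/(lt_le_trans (e0 n)).
  - by move=> x ex; have [] := dF x (lt_trans (e0 n) ex).
  - apply: cvg_at_right_filter; apply: differentiable_continuous.
    by apply/derivable1_diffP; have [] := dF _ (e0 n).
  - move=> x; rewrite in_itv /= andbT => ex; rewrite derive1E.
    by have [] := dF x (lt_trans (e0 n) ex).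
have Dcup : @Rpos R = \bigcup_n `[e n, +oo[%classic.
  apply/seteqP; split => x; rewrite RposE; last first.
    by case=> n _; rewrite /= in_itv /= andbT; exact/lt_le_trans.
  move=> x0; exists (Num.truncn x^-1) => //; rewrite /= in_itv /= andbT.
  by rewrite /e invf_ple ?posrE// ltW// truncnS_gt.
have mf (A : set R) : measurable A -> A `<=` @Rpos R -> measurable_fun A (EFin \o f).
  move=> mA AD; apply/measurable_EFinP; apply: (measurable_funS _ AD) => //.
  have cD : {in @Rpos R, continuous f} by move=> x; rewrite inE RposE; exact: cf.
  exact: open_continuous_measurable_fun (@open_Rpos R) cD.
have sub n : `[e n, +oo[%classic `<=` @Rpos R.
  by move=> x /=; rewrite RposE in_itv /= andbT; exact/lt_le_trans.
have lim : (\int[lebesgue_measure]_(x in `[e n, +oo[) (f x)%:E)%E @[n --> \oo] -->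
    (\int[lebesgue_measure]_(x in \bigcup_n `[e n, +oo[%classic) (f x)%:E)%E.
  apply: ge0_nondecreasing_set_cvg_integral.
  - apply/nondecreasing_seqP => n; rewrite subsetEset => x /=.
  rewrite !in_itv /= !andbT; apply: le_trans.
  by rewrite lef_pV2 ?posrE// ler_nat.
- by move=> n; exact: measurable_itv.
- by move=> n; apply: mf; [exact: measurable_itv | exact: sub].
- by move=> n x /sub; rewrite RposE lee_fin; exact: f0.
move: lim; rewrite -Dcup => /cvg_lim <- //; apply/cvg_lim => //.
under eq_fun do rewrite He.
apply: cvg_EFin; first exact: nearW.
apply: cvgB; first exact: cvg_cst.
have /cvg_at_rightP : F x @[x --> 0^'+] --> a by [].
apply; split=> //.
exact: cvg_harmonic.
Qed.

Lemma cvgy_sqrt (R : realType) : Num.sqrt x @[x --> +oo] --> (+oo : set_system R).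
Proof.
apply/cvgryPge => A; near=> x.
have [A0|A0] := leP A 0; first exact: le_trans (sqrtr_ge0 _).
rewrite -[A]gtr0_norm// -sqrtr_sqr ler_wsqrtr//.
Unshelve. all: by end_near. Qed.

(** The change of variable y = v^2 built into the primitive, so that integrands
    rational in sqrt y only need a primitive in v. *)
Lemma ge0_integral_Rpos_sqrt (R : realType) (f F : R -> R) (a b : R) :
  (forall v, 0 < v -> 0 <= f v) ->
  (forall v, 0 < v -> {for v, continuous f}) ->
  (forall v : R, 0 < v -> is_derive v 1 F (2 * v * f v)) ->
  F v @[v --> 0^'+] --> a -> F v @[v --> +oo] --> b ->
  (\int[lebesgue_measure]_(y in @Rpos R) (f (Num.sqrt y))%:E = (b - a)%:E)%E.
Proof.
move=> f0 cf dF Fa Fb.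
apply: (ge0_integral_Rpos_FTC (F := F \o Num.sqrt)).
- by move=> x x0; apply: f0; rewrite sqrtr_gt0.
- move=> x x0; apply: continuous_comp; first exact: sqrt_continuous.
  by apply: cf; rewrite sqrtr_gt0.
- move=> x x0; have sx : 0 < Num.sqrt x by rewrite sqrtr_gt0.
  have := is_derive1_sqrt x0; have := dF _ sx => d1 d2.
  have d3 := @is_derive1_comp _ _ _ _ _ _ d1 d2.
  apply: (is_derive_eq d3).
  by rewrite mulrC mulrA mulVf ?mul1r// mulf_neq0// gt_eqF.
- apply/cvg_at_rightP => u [u0 uc].
  have /cvg_at_rightP Fa' := Fa; apply: (Fa' (Num.sqrt \o u)); split.
    by move=> n; rewrite sqrtr_gt0.
  have := @sqrt_continuous R 0; rewrite /continuous_at sqrtr0 => sc.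
  exact: (cvg_comp _ _ uc sc).
- exact: cvg_comp (@cvgy_sqrt R) Fb.
Qed.

(** * Derivatives and limits of the elementary primitives *)

Lemma is_derive_addf (R : realType) (f g : R -> R) (x a b : R) :
  is_derive x 1 f a -> is_derive x 1 g b ->
  is_derive x 1 (fun y => f y + g y) (a + b).
Proof. by move=> df dg; exact: (is_deriveD df dg). Qed.

Lemma is_derive_scalef (R : realType) (f : R -> R) (x a c : R) :
  is_derive x 1 f a -> is_derive x 1 (fun y => c * f y) (c * a).
Proof. by move=> df; exact: (is_deriveZ c df). Qed.

Lemma is_derive_lnf (R : realType) (f : R -> R) (x a : R) :
  0 < f x -> is_derive x 1 f a -> is_derive x 1 (fun y => ln (f y)) (a / f x).
Proof.
move=> f0 df; have dl := is_derive1_ln f0; rewrite mulrC.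
exact: (@is_derive1_comp _ (@ln R) f x _ _ dl df).
Qed.

Lemma is_derive_ln_add (R : realType) (c v : R) : 0 < c -> 0 < v ->
  is_derive v 1 (fun v => ln (v + c)) (v + c)^-1.
Proof.
move=> c0 v0; have dv : is_derive v 1 (fun v : R => v + c) (1 + 0).
  exact: is_derive_addf.
by apply: (is_derive_eq (is_derive_lnf _ dv)); rewrite ?addr_gt0// addr0 mul1r.
Qed.

Lemma is_derive_ln_sqr_add (R : realType) (c v : R) : 0 < c -> 0 < v ->
  is_derive v 1 (fun v => ln (v ^+ 2 + c)) (2 * v / (v ^+ 2 + c)).
Proof.
move=> c0 v0; have dv : is_derive v 1 (fun v : R => v ^+ 2 + c) (2 * v + 0).
  apply: is_derive_addf; apply: (is_derive_eq (is_deriveX 2 (is_derive_id v 1))).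
  by rewrite expr1 /GRing.scale/= mulr1.
by apply: (is_derive_eq (is_derive_lnf _ dv)); rewrite ?addr_gt0 ?exprn_gt0// addr0.
Qed.

Lemma is_derive_atan_div (R : realType) (p v : R) : 0 < p ->
  is_derive v 1 (fun v => atan (v / p)) (p / (v ^+ 2 + p ^+ 2)).
Proof.
move=> p0; have dv : is_derive v 1 (fun v : R => p^-1 * v) (p^-1 * 1).
  exact: is_derive_scalef.
have -> : (fun v => atan (v / p)) = atan \o (fun v : R => p^-1 * v).
  by apply/funext => y /=; rewrite mulrC.
have dl := is_derive1_atan (p^-1 * v).
apply: (is_derive_eq (@is_derive1_comp _ _ _ _ _ _ dl dv)).
have p0' : p != 0 by rewrite gt_eqF.
have : v ^+ 2 + p ^+ 2 != 0 by rewrite gt_eqF// ltr_wpDl ?sqr_ge0// exprn_gt0.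
by move=> h; field; rewrite p0' /= ?h// addrC h.
Qed.

(** In each primitive below the coefficients of the logarithms, weighted by the
    degrees of their arguments, add up to zero; comparing every logarithm with
    ln v therefore gives the limit at infinity. *)
Lemma cvgy_ln_add (R : realType) (c : R) : 0 < c ->
  ln (v + c) - ln v @[v --> +oo] --> (0 : R).
Proof.
move=> c0; apply: (@squeeze_cvgr _ _ _ _ (fun=> 0) (fun v => c * v^-1)).
- near=> v; have v0 : 0 < v by near: v; exact: nbhs_pinfty_gt.
  have e : v + c = v * (1 + c / v) by field; rewrite gt_eqF.
  have cv : 0 < c / v by rewrite divr_gt0.
  rewrite e lnM ?posrE// ?addr_gt0// [X in X - _]addrC addrK.
  apply/andP; split; first by rewrite ln_ge0// lerDl ltW.
  by rewrite le_ln1Dx// (lt_trans _ cv).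
- exact: cvg_cst.
- rewrite -[X in _ --> X](mulr0 c); apply: cvgM; first exact: cvg_cst.
  apply/gtr0_cvgV0; [exact: nbhs_pinfty_gt|exact: cvg_id].
Unshelve. all: by end_near. Qed.

Lemma cvgy_sqr (R : realType) : v ^+ 2 @[v --> +oo] --> (+oo : set_system R).
Proof.
apply/cvgryPge => A; near=> v.
have v1 : 1 <= v by near: v; exact: nbhs_pinfty_ge.
rewrite (@le_trans _ _ v)//; last by rewrite expr2 ler_peMl// (le_trans _ v1).
Unshelve. all: by end_near. Qed.

Lemma cvgy_ln_sqr_add (R : realType) (c : R) : 0 < c ->
  ln (v ^+ 2 + c) - 2 * ln v @[v --> +oo] --> (0 : R).
Proof.
move=> c0; have := cvg_comp _ _ (@cvgy_sqr R) (cvgy_ln_add c0).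
apply: cvg_trans; apply: near_eq_cvg; near=> v => /=.
by rewrite lnXn// -[_ *+ 2]mulr_natl.
Unshelve. all: by end_near. Qed.

Lemma cvgy_atan_div (R : realType) (p : R) : 0 < p ->
  atan (v / p) @[v --> +oo] --> (pi / 2 : R).
Proof.
move=> p0; apply: cvg_comp (@cvgy_atan R).
apply/cvgryPge => A; near=> v.
rewrite ler_pdivlMr//; near: v; exact: nbhs_pinfty_ge.
Unshelve. all: by end_near. Qed.

Lemma cvg0_atan_div (R : realType) (p : R) : 
  atan (v / p) @[v --> 0^'+] --> (0 : R).
Proof.
have : {for (0:R), continuous (fun v : R => atan (v / p))}.
  apply: continuous_comp; last exact: continuous_atan.
  by apply: cvgM; [exact: cvg_id|exact: cvg_cst].
by move/cvg_at_right_filter; rewrite mul0r atan0.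
Qed.

Lemma cvg0_ln_add (R : realType) (c : R) : 0 < c ->
  ln (v + c) @[v --> 0^'+] --> (ln c : R).
Proof.
move=> c0; have : {for (0:R), continuous (fun v : R => ln (v + c))}.
  apply: continuous_comp; last by apply: continuous_ln; rewrite add0r.
  by apply: cvgD; [exact: cvg_id|exact: cvg_cst].
by move/cvg_at_right_filter; rewrite add0r.
Qed.

Lemma cvg0_ln_sqr_add (R : realType) (c : R) : 0 < c ->
  ln (v ^+ 2 + c) @[v --> 0^'+] --> (ln c : R).
Proof.
move=> c0; have : {for (0:R), continuous (fun v : R => ln (v ^+ 2 + c))}.
  apply: continuous_comp; last by apply: continuous_ln; rewrite expr0n add0r.
  by apply: cvgD; [exact: exprn_continuous|exact: cvg_cst].
by move/cvg_at_right_filter; rewrite expr0n add0r.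
Qed.

(** * Four explicit integrals *)

Lemma integral_Rpos_two_poles (R : realType) (x t : R) :
  0 < x -> 0 < t -> x != t ->
  (\int[lebesgue_measure]_(y in @Rpos R) ((x + y)^-1 * (y + t)^-1)%:E =
   ((ln x - ln t) / (x - t))%:E)%E.
Proof.
move=> x0 t0 xt; have xt0 : x - t != 0 by rewrite subr_eq0.
pose F y := (x - t)^-1 * ln (y + t) + - (x - t)^-1 * ln (y + x).
have -> : (ln x - ln t) / (x - t) =
    0 - ((x - t)^-1 * ln t + - (x - t)^-1 * ln x) by ring.
apply: (ge0_integral_Rpos_FTC (f := fun y => (x + y)^-1 * (y + t)^-1) (F := F)).
- by move=> y y0; rewrite mulr_ge0// invr_ge0 ltW// addr_gt0.
- move=> y y0; apply: (cvgM (cvgV _ (cvgD (cvg_cst x) cvg_id))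
    (cvgV _ (cvgD cvg_id (cvg_cst t)))); by rewrite gt_eqF// addr_gt0.
- move=> y y0.
  have d := is_derive_addf (is_derive_scalef (x - t)^-1 (is_derive_ln_add t0 y0))
    (is_derive_scalef (- (x - t)^-1) (is_derive_ln_add x0 y0)).
  apply: (is_derive_eq d).
  have xy : x + y != 0 by rewrite gt_eqF// addr_gt0.
  have yt : y + t != 0 by rewrite gt_eqF// addr_gt0.
  by rewrite (addrC y x); field; rewrite xt0 yt xy.
- by apply: cvgD; apply: cvgM; (try exact: cvg_cst); apply: cvg0_ln_add.
- have -> : (0 : R) = (x - t)^-1 * 0 + - (x - t)^-1 * 0 by ring.
  have : (x - t)^-1 * (ln (v + t) - ln v) + - (x - t)^-1 * (ln (v + x) - ln v)
      @[v --> +oo] --> (x - t)^-1 * 0 + - (x - t)^-1 * 0.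
    by apply: cvgD; (apply: cvgM; first exact: cvg_cst); exact: cvgy_ln_add.
  apply: cvg_trans; apply: near_eq_cvg; near=> v.
  by rewrite /F /=; ring.
Unshelve. all: by end_near. Qed.

(** The integral behind the Schur test: t^(-1/2) is an eigenfunction of the
    Stieltjes transform. *)
Lemma integral_Rpos_sqrt_pole (R : realType) (p : R) : 0 < p ->
  (\int[lebesgue_measure]_(t in @Rpos R) ((Num.sqrt t)^-1 * (p ^+ 2 + t)^-1)%:E =
   (pi / p)%:E)%E.
Proof.
move=> p0; pose f (v : R) := v^-1 * (p ^+ 2 + v ^+ 2)^-1.
transitivity (\int[lebesgue_measure]_(t in @Rpos R) (f (Num.sqrt t))%:E)%E.
  by apply: eq_integral => t; rewrite inE RposE => t0; rewrite /f sqr_sqrtr// ltW.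
have -> : pi / p = 2 / p * (pi / 2) - 2 / p * 0.
  by field; rewrite gt_eqF.
have sn v : p ^+ 2 + v ^+ 2 != 0 by rewrite gt_eqF// ltr_wpDr ?sqr_ge0// exprn_gt0.
apply: (ge0_integral_Rpos_sqrt (f := f) (F := fun v => 2 / p * atan (v / p))).
- by move=> v v0; rewrite mulr_ge0// invr_ge0 ?addr_ge0 ?sqr_ge0// ltW.
- move=> v v0; have v2 : v != 0 by rewrite gt_eqF.
  exact: (cvgM (cvgV v2 cvg_id)
    (cvgV (sn v) (cvgD (cvg_cst (p ^+ 2)) (@exprn_continuous _ 2 v)))).
- move=> v v0.
  apply: (is_derive_eq (is_derive_scalef (2 / p) (is_derive_atan_div v p0))).
  by rewrite /f addrC; field; rewrite sn !gt_eqF.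
- by apply: cvgM; [exact: cvg_cst|exact: cvg0_atan_div].
- by apply: cvgM; [exact: cvg_cst|exact: cvgy_atan_div].
Qed.

(** Partial fractions in v = sqrt s; each pole contributes an arctangent. *)
Lemma integral_Rpos_sqrt_three_poles (R : realType) (p q r : R) :
  0 < p -> 0 < q -> 0 < r -> p != q -> q != r -> r != p ->
  (\int[lebesgue_measure]_(s in @Rpos R)
     (Num.sqrt s * ((p ^+ 2 + s) * (s + q ^+ 2) * (s + r ^+ 2))^-1)%:E =
   (pi / ((p + q) * (q + r) * (r + p)))%:E)%E.
Proof.
move=> p0 q0 r0 pq qr rp.
pose f (v : R) := v * ((p ^+ 2 + v ^+ 2) * (v ^+ 2 + q ^+ 2) * (v ^+ 2 + r ^+ 2))^-1.
transitivity (\int[lebesgue_measure]_(t in @Rpos R) (f (Num.sqrt t))%:E)%E.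
  by apply: eq_integral => t; rewrite inE RposE => t0; rewrite /f sqr_sqrtr// ltW.
(* the coefficient of 1 / (v^2 + a^2) in 2 v (f v), divided by a *)
pose c (a b d : R) := - (2 * a / ((b ^+ 2 - a ^+ 2) * (d ^+ 2 - a ^+ 2))).
pose F v := c p q r * atan (v / p) + (c q r p * atan (v / q) + c r p q * atan (v / r)).
have dn (a b : R) : 0 < a -> 0 < b -> a != b ->
    [/\ a - b != 0, b - a != 0 & a + b != 0].
  by move=> a0 b0 ab; rewrite !subr_eq0 (eq_sym b) ab gt_eqF ?addr_gt0.
have [pq1 pq2 pq3] := dn _ _ p0 q0 pq; have [qr1 qr2 qr3] := dn _ _ q0 r0 qr.
have [rp1 rp2 rp3] := dn _ _ r0 p0 rp.
have dn2 (a b : R) : a + b != 0 -> a - b != 0 -> a ^+ 2 - b ^+ 2 != 0.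
  by move=> ab1 ab2; rewrite subr_sqr mulf_neq0.
have sn (a v : R) : 0 < a -> a ^+ 2 + v ^+ 2 != 0.
  by move=> a0; rewrite gt_eqF// ltr_wpDr ?sqr_ge0// exprn_gt0.
have -> : pi / ((p + q) * (q + r) * (r + p)) =
   (c p q r * (pi / 2) + (c q r p * (pi / 2) + c r p q * (pi / 2))) -
   (c p q r * 0 + (c q r p * 0 + c r p q * 0)).
  rewrite /c !subr_sqr; field.
  by rewrite ?(addrC q p) ?(addrC r q) ?(addrC p r) pq1 pq2 pq3 qr1 qr2 qr3 rp1 rp2 rp3.
apply: (ge0_integral_Rpos_sqrt (f := f) (F := F)).
- move=> v v0; rewrite mulr_ge0 ?(ltW v0)// invr_ge0.
  by rewrite !mulr_ge0 ?addr_ge0 ?sqr_ge0.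
- move=> v v0; have c2 := @exprn_continuous R 2 v.
  apply: (cvgM cvg_id (cvgV _ (cvgM (cvgM (cvgD (cvg_cst (p ^+ 2)) c2)
    (cvgD c2 (cvg_cst (q ^+ 2)))) (cvgD c2 (cvg_cst (r ^+ 2)))))).
  by rewrite !(addrC (v ^+ 2)) !mulf_neq0 ?sn.
- move=> v v0.
  have d := is_derive_addf (is_derive_scalef (c p q r) (is_derive_atan_div v p0))
    (is_derive_addf (is_derive_scalef (c q r p) (is_derive_atan_div v q0))
                    (is_derive_scalef (c r p q) (is_derive_atan_div v r0))).
  apply: (is_derive_eq d).
  rewrite /f /c !(addrC (v ^+ 2)); field.
  by rewrite !sn// !dn2// ?(addrC q p) ?(addrC r q) ?(addrC p r).
- by apply: cvgD; [|apply: cvgD]; (apply: cvgM; [exact: cvg_cst|exact: cvg0_atan_div]).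
- by apply: cvgD; [|apply: cvgD]; (apply: cvgM; [exact: cvg_cst|exact: cvgy_atan_div]).
Qed.

(** Partial fractions in v = sqrt y; A, B, C, E are the coefficients of the
    primitives attached to v + r, v + p and, for the last two, v^2 + r^2. *)
Lemma integral_Rpos_mixed_poles (R : realType) (p r : R) :
  0 < p -> 0 < r -> p != r ->
  (\int[lebesgue_measure]_(y in @Rpos R)
     (((y + r ^+ 2) * (p + Num.sqrt y) * (Num.sqrt y + r))^-1)%:E =
   (pi * (p + r) / (2 * r * (p ^+ 2 + r ^+ 2)) -
    2 * p * (ln p - ln r) / ((p ^+ 2 + r ^+ 2) * (p - r)))%:E)%E.
Proof.
move=> p0 r0 pr; have pr0 : p - r != 0 by rewrite subr_eq0.
pose f (v : R) := ((v ^+ 2 + r ^+ 2) * (p + v) * (v + r))^-1.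
transitivity (\int[lebesgue_measure]_(t in @Rpos R) (f (Num.sqrt t))%:E)%E.
  by apply: eq_integral => t; rewrite inE RposE => t0; rewrite /f sqr_sqrtr// ltW.
have sn (a v : R) : 0 < a -> v ^+ 2 + a ^+ 2 != 0.
  by move=> a0; rewrite gt_eqF// ltr_wpDl ?sqr_ge0// exprn_gt0.
have r2 : 0 < r ^+ 2 by rewrite exprn_gt0.
pose A := - (r * (p - r))^-1.
pose B := 2 * p / ((p ^+ 2 + r ^+ 2) * (p - r)).
pose C := (p - r) / (2 * r * (p ^+ 2 + r ^+ 2)).
pose E := (p + r) / (r * (p ^+ 2 + r ^+ 2)).
(* no logarithm survives at infinity *)
have ABC : A + B + 2 * C = 0.
  by rewrite /A /B /C; field; rewrite sn// pr0 gt_eqF.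
pose F v := (A * ln (v + r) + B * ln (v + p)) + (C * ln (v ^+ 2 + r ^+ 2) + E * atan (v / r)).
have -> : pi * (p + r) / (2 * r * (p ^+ 2 + r ^+ 2)) -
    2 * p * (ln p - ln r) / ((p ^+ 2 + r ^+ 2) * (p - r)) =
   E * (pi / 2) - ((A * ln r + B * ln p) + (C * ln (r ^+ 2) + E * 0)).
  rewrite lnXn// -[_ *+ 2]mulr_natl.
  have -> : A = - B - 2 * C by rewrite -[LHS]subr0 -ABC; ring.
  by rewrite /B /C /E; field; rewrite sn// pr0 gt_eqF.
apply: (ge0_integral_Rpos_sqrt (f := f) (F := F)).
- by move=> v v0; rewrite invr_ge0 !mulr_ge0 ?addr_ge0 ?sqr_ge0// ltW.
- move=> v v0; have c2 := @exprn_continuous R 2 v.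
  apply: (cvgV _ (cvgM (cvgM (cvgD c2 (cvg_cst (r ^+ 2)))
    (cvgD (cvg_cst p) cvg_id)) (cvgD cvg_id (cvg_cst r)))).
  by rewrite !mulf_neq0 ?sn// gt_eqF// addr_gt0.
- move=> v v0.
  have d := is_derive_addf
    (is_derive_addf (is_derive_scalef A (is_derive_ln_add r0 v0))
                    (is_derive_scalef B (is_derive_ln_add p0 v0)))
    (is_derive_addf (is_derive_scalef C (is_derive_ln_sqr_add r2 v0))
                    (is_derive_scalef E (is_derive_atan_div v r0))).
  apply: (is_derive_eq d).
  have : v + r != 0 /\ p + v != 0 by split; rewrite gt_eqF// addr_gt0.
  move=> [vr vp]; rewrite /f /A /B /C /E (addrC v p); field.
  by rewrite !sn// pr0 vr vp gt_eqF.
- apply: cvgD; apply: cvgD; apply: cvgM; (try exact: cvg_cst);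
    (try exact: cvg0_ln_add); [exact: cvg0_ln_sqr_add|exact: cvg0_atan_div].
- have -> : E * (pi / 2) = (A * 0 + B * 0) + (C * 0 + E * (pi / 2)) by ring.
  have : (A * (ln (v + r) - ln v) + B * (ln (v + p) - ln v)) +
      (C * (ln (v ^+ 2 + r ^+ 2) - 2 * ln v) + E * atan (v / r))
      @[v --> +oo] --> (A * 0 + B * 0) + (C * 0 + E * (pi / 2)).
    apply: cvgD; apply: cvgD; (apply: cvgM; first exact: cvg_cst).
    - exact: cvgy_ln_add.
    - exact: cvgy_ln_add.
    - exact: cvgy_ln_sqr_add.
    - exact: cvgy_atan_div.
  apply: cvg_trans; apply: near_eq_cvg; near=> v.
  rewrite /F /=; have -> : A = - B - 2 * C by rewrite -[LHS]subr0 -ABC; ring.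
  by ring.
Unshelve. all: by end_near. Qed.

(** * Tonelli's theorem on the quadrant *)

Lemma measurable_invr (R : realType) : measurable_fun [set: R] (@GRing.inv R).
Proof.
have -> : [set: R] = [set 0] `|` ~` [set 0] by rewrite setUCr.
apply/measurable_funU; [by []|exact: measurableC|split].
  exact: measurable_fun_set1.
have o : open (~` [set (0 : R)]) by apply: closed_openC; exact: closed_eq.
have c : {in ~` [set (0 : R)], continuous (@GRing.inv R)}.
  by move=> x; rewrite inE /= => /eqP x0; exact: cvgV.
exact: open_continuous_measurable_fun o c.
Qed.

Section Tonelli.
Variables (R : realType) (F : R -> R -> R).
Hypothesis mF : measurable_fun (@Rpos R `*` @Rpos R) (fun p => F p.1 p.2).
Hypothesis F0 : forall x y, 0 < x -> 0 < y -> 0 <= F x y.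
Notation mu := (@lebesgue_measure R).
Local Open Scope ereal_scope.

(* F is measurable only on the quadrant, hence the extension by 0. *)
Let Fbar := (fun p : R * R => (F p.1 p.2)%:E) \_ (@Rpos R `*` @Rpos R).

Let mFbar : measurable_fun [set: R * R] Fbar.
Proof.
apply/(measurable_restrictT _ _).1; first exact: measurableX.
exact/measurable_EFinP.
Qed.

Let Fbar0 p : 0 <= Fbar p.
Proof.
apply: erestrict_ge0 => -[x y] [/=]; rewrite !RposE => x0 y0.
by rewrite lee_fin F0.
Qed.

Let Fbar_l x : \int[mu]_y Fbar (x, y) =
  ((fun x => \int[mu]_(y in @Rpos R) (F x y)%:E) \_ (@Rpos R)) x.
Proof.
rewrite patchE; case: ifPn => xD.
  rewrite [RHS]integral_mkcond; apply: eq_integral => y _.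
  by rewrite /Fbar !patchE in_setX /= xD.
by apply: integral0_eq => y _; rewrite /Fbar patchE in_setX /= (negbTE xD).
Qed.

Let Fbar_r y : \int[mu]_x Fbar (x, y) =
  ((fun y => \int[mu]_(x in @Rpos R) (F x y)%:E) \_ (@Rpos R)) y.
Proof.
rewrite patchE; case: ifPn => yD.
  rewrite [RHS]integral_mkcond; apply: eq_integral => x _.
  by rewrite /Fbar !patchE in_setX /= yD andbT.
by apply: integral0_eq => x _; rewrite /Fbar patchE in_setX /= (negbTE yD) andbF.
Qed.

Lemma tonelli_Rpos :
  \int[mu]_(x in @Rpos R) \int[mu]_(y in @Rpos R) (F x y)%:E =
  \int[mu]_(y in @Rpos R) \int[mu]_(x in @Rpos R) (F x y)%:E.
Proof.
rewrite [LHS]integral_mkcond [RHS]integral_mkcond.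
under eq_integral do rewrite -Fbar_l.
under [RHS]eq_integral do rewrite -Fbar_r.
exact: fubini_tonelli.
Qed.

Lemma measurable_integral_Rpos_l :
  measurable_fun (@Rpos R) (fun x => \int[mu]_(y in @Rpos R) (F x y)%:E).
Proof.
apply/(measurable_restrictT _ _).2 => //.
have <- : fubini_F mu Fbar =
    (fun x => \int[mu]_(y in @Rpos R) (F x y)%:E) \_ (@Rpos R).
  by apply/funext => x; exact: Fbar_l.
exact: measurable_fun_fubini_tonelli_F.
Qed.

Lemma measurable_integral_Rpos_r :
  measurable_fun (@Rpos R) (fun y => \int[mu]_(x in @Rpos R) (F x y)%:E).
Proof.
apply/(measurable_restrictT _ _).2 => //.
have <- : fubini_G mu Fbar =
    (fun y => \int[mu]_(x in @Rpos R) (F x y)%:E) \_ (@Rpos R).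
  by apply/funext => y; exact: Fbar_r.
exact: measurable_fun_fubini_tonelli_G.
Qed.

End Tonelli.

(** Used to discard the diagonal and the coincidences of poles. *)
Lemma eq_integral_Rpos_countable (R : realType) (f g : R -> \bar R) (N : set R) :
  countable N ->
  measurable_fun (@Rpos R) f -> measurable_fun (@Rpos R) g ->
  (forall x, 0 < x -> (0 <= f x)%E) -> (forall x, 0 < x -> (0 <= g x)%E) ->
  (forall x, 0 < x -> ~ N x -> f x = g x) ->
  (\int[lebesgue_measure]_(x in @Rpos R) f x =
   \int[lebesgue_measure]_(x in @Rpos R) g x)%E.
Proof.
move=> cN mf mg f0 g0 fg; apply: ge0_ae_eq_integral => //.
- by move=> x; rewrite RposE; exact: f0.
- by move=> x; rewrite RposE; exact: g0.
- exists N; split.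
  + exact: countable_measurable.
  + exact: countable_lebesgue_measure0.
  + move=> x /= h; apply: contrapT => nN; apply: h; rewrite RposE => x0.
    exact: fg.
Qed.

(** * The logarithmic kernel and its Stieltjes transform *)

Lemma measurable_sqrtr (R : realType) : measurable_fun [set: R] (@Num.sqrt R).
Proof. by apply: continuous_measurable_fun; exact: sqrt_continuous. Qed.

Lemma measurable_stieltjes (R : realType) :
  measurable_fun [set: R * R] (fun p => (p.1 + p.2)^-1).
Proof.
apply: (measurableT_comp (@measurable_invr R)).
by apply: measurable_funD; [exact: measurable_fst|exact: measurable_snd].
Qed.

Lemma measurable_log_kernel (R : realType) :
  measurable_fun [set: R * R] (fun p => log_kernel p.1 p.2).
Proof.
have m1 : measurable_fun [set: R * R] (fun p => p.1) by exact: measurable_fst.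
have m2 : measurable_fun [set: R * R] (fun p => p.2) by exact: measurable_snd.
apply: measurable_funM; first apply: measurable_funM.
- by apply: (measurableT_comp (@measurable_sqrtr R)); exact: measurable_funM.
- by apply: measurable_funB; apply: (measurableT_comp (@measurable_ln R)).
- apply: (measurableT_comp (@measurable_invr R)).
  by apply: measurable_funB; exact: measurable_funX.
Qed.

Lemma log_kernelC (R : realType) (x t : R) : log_kernel x t = log_kernel t x.
Proof.
rewrite /log_kernel (mulrC t) -(opprB (ln x)) -(opprB (x ^+ 2)) invrN.
by rewrite !mulrN mulNr opprK.
Qed.

(** The representation of the logarithm as an integral of rational functions; it
    fails on the diagonal, where [log_kernel] is 0. *)
Lemma log_kernelE (R : realType) (x t : R) : 0 < x -> 0 < t -> x != t ->
  (log_kernel x t)%:E = ((Num.sqrt x * Num.sqrt t * (x + t)^-1)%:E *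
    \int[lebesgue_measure]_(y in @Rpos R) ((x + y)^-1 * (y + t)^-1)%:E)%E.
Proof.
move=> x0 t0 xt; rewrite integral_Rpos_two_poles// -EFinM /log_kernel.
rewrite sqrtrM ?ltW// subr_sqr; congr EFin; field.
by rewrite subr_eq0 xt gt_eqF// addr_gt0.
Qed.

Lemma log_kernel_ge0 (R : realType) (x t : R) : 0 < x -> 0 < t -> 0 <= log_kernel x t.
Proof.
move=> x0 t0; have [->|xt] := eqVneq x t.
  by rewrite /log_kernel !subrr mulr0 mul0r.
rewrite -lee_fin log_kernelE// mule_ge0//.
  by rewrite lee_fin !mulr_ge0 ?sqrtr_ge0// invr_ge0 addr_ge0 ?ltW.
apply: integral_ge0 => y; rewrite RposE => y0.
by rewrite lee_fin mulr_ge0// invr_ge0 addr_ge0 ?ltW.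
Qed.

Lemma sqrtr_neq (R : realType) (x y : R) : 0 < x -> 0 < y -> x != y ->
  Num.sqrt x != Num.sqrt y.
Proof. by move=> x0 y0; rewrite eqr_sqrt ?ltW. Qed.

(** The kernel identity S K = S - K, up to the constants 1/pi and 2/pi^2.
    Tonelli's theorem lets the integral over s, with its three poles -x, -y, -t,
    be computed before the one over y. *)
Lemma integral_stieltjes_log_kernel (R : realType) (x t : R) :
  0 < x -> 0 < t -> x != t ->
  (\int[lebesgue_measure]_(s in @Rpos R) ((x + s)^-1 * log_kernel s t)%:E =
   (pi ^+ 2 / 2 / (x + t) - pi * log_kernel x t)%:E)%E.
Proof.
move=> x0 t0 xt.
pose G s y := (Num.sqrt t * (y + t)^-1) *
  (Num.sqrt s * ((x + s) * (s + y) * (s + t))^-1).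
have mG : measurable_fun (@Rpos R `*` @Rpos R) (fun p => G p.1 p.2).
  apply: measurable_funTS.
  have m1 : measurable_fun [set: R * R] (fun p => p.1) by exact: measurable_fst.
  have m2 : measurable_fun [set: R * R] (fun p => p.2) by exact: measurable_snd.
  apply: measurable_funM; apply: measurable_funM => //.
  - by apply: (measurableT_comp (@measurable_invr R)); exact: measurable_funD.
  - exact: (measurableT_comp (@measurable_sqrtr R)).
  - apply: (measurableT_comp (@measurable_invr R)); apply: measurable_funM.
      by apply: measurable_funM; exact: measurable_funD.
    exact: measurable_funD.
have G0 s y : 0 < s -> 0 < y -> 0 <= G s y.
  move=> s0 y0; rewrite !mulr_ge0 ?sqrtr_ge0 ?invr_ge0 ?addr_ge0 ?ltW//.
  by rewrite !mulr_gt0// addr_gt0.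
have -> : (\int[lebesgue_measure]_(s in @Rpos R) ((x + s)^-1 * log_kernel s t)%:E =
    \int[lebesgue_measure]_(s in @Rpos R) \int[lebesgue_measure]_(y in @Rpos R) (G s y)%:E)%E.
  (* log_kernelE needs s <> t *)
  apply: (@eq_integral_Rpos_countable _ _ _ [set t]).
  - exact: finite_set_countable.
  - apply/measurable_EFinP; apply: measurable_funTS; apply: measurable_funM.
      apply: (measurableT_comp (@measurable_invr R)); exact: measurable_funD.
    exact: (measurable_fun_pair1 t (@measurable_log_kernel R)).
  - exact: measurable_integral_Rpos_l.
  - move=> s s0; rewrite lee_fin mulr_ge0 ?log_kernel_ge0// invr_ge0.
    by rewrite addr_ge0 ?ltW.
  - move=> s s0; apply: integral_ge0 => y; rewrite RposE lee_fin => y0.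
    exact: G0.
  - move=> s s0 /= /eqP st; rewrite EFinM log_kernelE// muleA -EFinM.
    rewrite -ge0_integralZl_EFin//; last 3 first.
    + move=> y; rewrite RposE => y0.
      by rewrite lee_fin mulr_ge0// invr_ge0 addr_ge0 ?ltW.
    + apply/measurable_EFinP; apply: measurable_funTS; apply: measurable_funM;
      by apply: (measurableT_comp (@measurable_invr R)); exact: measurable_funD.
    + by rewrite !mulr_ge0 ?sqrtr_ge0 ?invr_ge0 ?addr_ge0 ?ltW.
    apply: eq_integral => y; rewrite inE RposE => y0; rewrite -EFinM /G.
    by congr EFin; rewrite !invfM; ring.
rewrite tonelli_Rpos//.
pose p := Num.sqrt x; pose r := Num.sqrt t.
have p0 : 0 < p by rewrite sqrtr_gt0.
have r0 : 0 < r by rewrite sqrtr_gt0.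
have p2 : p ^+ 2 = x by rewrite sqr_sqrtr// ltW.
have r2 : r ^+ 2 = t by rewrite sqr_sqrtr// ltW.
have pr : p != r by exact: sqrtr_neq.
pose H y := pi * r / (r + p) * ((y + r ^+ 2) * (p + Num.sqrt y) * (Num.sqrt y + r))^-1.
have mH : measurable_fun [set: R]
    (fun y => ((y + r ^+ 2) * (p + Num.sqrt y) * (Num.sqrt y + r))^-1).
  have m1 := @measurable_sqrtr R.
  apply: (measurableT_comp (@measurable_invr R)); apply: measurable_funM.
    by apply: measurable_funM; exact: measurable_funD.
  exact: measurable_funD.
have H0 y : 0 < y -> 0 <= ((y + r ^+ 2) * (p + Num.sqrt y) * (Num.sqrt y + r))^-1.
  by move=> y0; rewrite invr_ge0 !mulr_ge0 ?addr_ge0 ?sqr_ge0 ?sqrtr_ge0// ltW.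
have prH : 0 <= pi * r / (r + p).
  by rewrite !mulr_ge0 ?invr_ge0 ?pi_ge0 ?addr_ge0 ?(ltW p0) ?(ltW r0).
have -> : (\int[lebesgue_measure]_(y in @Rpos R) \int[lebesgue_measure]_(s in @Rpos R) (G s y)%:E =
    \int[lebesgue_measure]_(y in @Rpos R) (H y)%:E)%E.
  (* the three poles must be distinct *)
  apply: (@eq_integral_Rpos_countable _ _ _ [set x; t]).
  - exact: finite_set_countable.
  - exact: measurable_integral_Rpos_r.
  - by apply/measurable_EFinP; apply: measurable_funTS; exact: measurable_funM.
  - move=> y y0; apply: integral_ge0 => s; rewrite RposE lee_fin => s0.
    exact: G0.
  - by move=> y y0; rewrite lee_fin mulr_ge0// H0.
  - move=> y y0 /= /not_orP[/eqP yx /eqP yt].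
    have q0 : 0 < Num.sqrt y by rewrite sqrtr_gt0.
    have q2 : Num.sqrt y ^+ 2 = y by rewrite sqr_sqrtr// ltW.
    rewrite /G; under eq_integral do rewrite EFinM.
    rewrite ge0_integralZl_EFin//; last 3 first.
    + move=> s; rewrite RposE => s0; rewrite lee_fin mulr_ge0 ?sqrtr_ge0 ?invr_ge0//.
      by rewrite !mulr_ge0// addr_ge0// ltW.
    + have m1 := @measurable_sqrtr R.
      apply/measurable_EFinP; apply: measurable_funTS; apply: measurable_funM => //.
      apply: (measurableT_comp (@measurable_invr R)); apply: measurable_funM.
        by apply: measurable_funM; exact: measurable_funD.
      exact: measurable_funD.
    + by rewrite mulr_ge0 ?sqrtr_ge0 ?invr_ge0 ?addr_ge0 ?ltW.
    have := @integral_Rpos_sqrt_three_poles R p (Num.sqrt y) r p0 q0 r0.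
    rewrite p2 r2 q2 => ->; last 3 first.
    + by rewrite eq_sym; exact: sqrtr_neq.
    + exact: sqrtr_neq.
    + by rewrite eq_sym.
    rewrite -EFinM /H r2 -/r; congr EFin.
    by rewrite !invfM; ring.
rewrite /H; under eq_integral do rewrite EFinM.
rewrite ge0_integralZl_EFin//; last 2 first.
- by move=> y; rewrite RposE => y0; rewrite lee_fin H0.
- by apply/measurable_EFinP; exact: measurable_funTS.
rewrite integral_Rpos_mixed_poles// -EFinM; congr EFin.
rewrite /log_kernel sqrtrM ?ltW// -/p -/r -p2 -r2.
have ln2 z : 0 < z -> ln (z ^+ 2) = 2 * ln z :> R.
  by move=> z0; rewrite lnXn// mulr2n mulr_natl mulr2n.
rewrite !ln2// (subr_sqr (p ^+ 2)) (subr_sqr p).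
have h1 : p - r != 0 by rewrite subr_eq0.
have h2 : p + r != 0 by rewrite gt_eqF// addr_gt0.
have h3 : p ^+ 2 + r ^+ 2 != 0 by rewrite gt_eqF// addr_gt0// exprn_gt0.
by field; rewrite ?(addrC r p) h1 h2 h3 gt_eqF.
Qed.

(** * Integral operators dominated by the Stieltjes kernel *)

Section L2_kernels.
Variable R : realType.
Implicit Types (f g h : R -> R) (k : R -> R -> R).
Notation mu := (@lebesgue_measure R).
Notation D := (@Rpos R).

Definition L2real f : Prop :=
  measurable_fun D f /\ (\int[mu]_(x in D) (f x ^+ 2)%:E < +oo)%E.

Definition kernel_op k f (x : R) : R := \int[mu]_(t in D) (k x t * f t).

(** A class of kernels that contains s, k and s - k, and on which nonnegativity
    makes Tonelli's theorem available. *)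
Definition stieltjes_dominated k : Prop :=
  measurable_fun [set: R * R] (fun p => k p.1 p.2) /\
  exists2 C, 0 <= C &
    forall x t, 0 < x -> 0 < t -> 0 <= k x t <= C * (x + t)^-1.

Lemma integrable_Rpos_scale c f : mu.-integrable D (EFin \o f) ->
  mu.-integrable D (EFin \o (fun t => c * f t)).
Proof. by move=> if_; refine (integrableZl _ c if_). Qed.

Lemma L2real_dominated f g c : 0 <= c -> measurable_fun D f -> L2real g ->
  (forall x, 0 < x -> f x ^+ 2 <= c * g x ^+ 2) -> L2real f.
Proof.
move=> c0 mf [mg g2] fg; split => //.
have m2 : measurable_fun D (fun x => (g x ^+ 2)%:E).
  by apply/measurable_EFinP; exact: measurable_funX.
apply: (@le_lt_trans _ _ (c%:E * \int[mu]_(x in D) (g x ^+ 2)%:E)%E).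
  rewrite -ge0_integralZl_EFin//; last by move=> x _; rewrite lee_fin sqr_ge0.
  apply: ge0_le_integral => //.
  - by move=> x _; rewrite lee_fin sqr_ge0.
  - by apply/measurable_EFinP; exact: measurable_funX.
  - exact: measurable_funeM.
  - by move=> x; rewrite RposE -EFinM lee_fin; exact: fg.
by rewrite lte_mul_pinfty// lee_fin.
Qed.

Lemma L2real_lin f g c : L2real f -> L2real g -> L2real (fun x => f x + c * g x).
Proof.
move=> [mf f2] [mg g2].
have mc : measurable_fun D (fun x => c * g x) by exact: measurable_funM.
split; first exact: measurable_funD.
have mf2 : measurable_fun D (fun x => (f x ^+ 2)%:E).
  by apply/measurable_EFinP; exact: measurable_funX.
have mg2 : measurable_fun D (fun x => (g x ^+ 2)%:E).
  by apply/measurable_EFinP; exact: measurable_funX.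
have c2 : 0 <= 2 * c ^+ 2 by rewrite mulr_ge0// sqr_ge0.
apply: (@le_lt_trans _ _ (2%:E * \int[mu]_(x in D) (f x ^+ 2)%:E +
    (2 * c ^+ 2)%:E * \int[mu]_(x in D) (g x ^+ 2)%:E)%E).
  rewrite -!ge0_integralZl_EFin//; do ?[by move=> x _; rewrite lee_fin sqr_ge0].
  rewrite -ge0_integralD//.
  - apply: ge0_le_integral => //.
    + by move=> x _; rewrite lee_fin sqr_ge0.
    + by apply/measurable_EFinP; apply: measurable_funX; exact: measurable_funD.
    + by apply: emeasurable_funD; exact: measurable_funeM.
    + move=> x _; rewrite -!EFinM -EFinD lee_fin.
      by have := sqr_ge0 (f x - c * g x); lra.
  - by move=> x _; rewrite -EFinM lee_fin mulr_ge0// sqr_ge0.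
  - exact: measurable_funeM.
  - by move=> x _; rewrite -EFinM lee_fin mulr_ge0// sqr_ge0.
  - exact: measurable_funeM.
by rewrite lte_add_pinfty// lte_mul_pinfty// lee_fin.
Qed.

Lemma L2real_funrpos f : L2real f -> L2real f^\+.
Proof.
move=> Lf; apply: (@L2real_dominated _ f 1) => //.
  by case: Lf => mf _; exact: measurable_funrpos.
move=> x _; rewrite mul1r /funrpos /Num.max /Order.max.
by case: ifPn => // _; rewrite expr0n sqr_ge0.
Qed.

Lemma L2real_funrneg f : L2real f -> L2real f^\-.
Proof.
move=> Lf; apply: (@L2real_dominated _ f 1) => //.
  by case: Lf => mf _; exact: measurable_funrneg.
move=> x _; rewrite mul1r /funrneg /Num.max /Order.max.
by case: ifPn => // _; rewrite ?sqrrN// expr0n sqr_ge0.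
Qed.

Lemma dominated_measurable k x f : stieltjes_dominated k -> measurable_fun D f ->
  measurable_fun D (fun t => k x t * f t).
Proof.
move=> [mk _] mf; apply: measurable_funM => //.
by apply: measurable_funTS; exact: (measurable_fun_pair2 x mk).
Qed.

Lemma dominated_measurable2 k f : stieltjes_dominated k -> measurable_fun D f ->
  measurable_fun (D `*` D) (fun p => k p.1 p.2 * f p.2).
Proof.
move=> [mk _] mf; apply: measurable_funM; first exact: measurable_funTS.
apply: (measurable_comp (F := D)) => //.
  by move=> _ [[x t] [_ ?] <-].
by apply: measurable_funTS; exact: measurable_snd.
Qed.

(** Convergence at every x > 0, not only almost everywhere: by the
    arithmetic-geometric mean |f| / (x + t) <= f^2 + 1 / (x + t)^2, and
    1 / (x + t)^2 <= x^(-1/2) t^(-1/2) / (x + t), which is integrable. *)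
Lemma dominated_integrable k f x : stieltjes_dominated k -> L2real f -> 0 < x ->
  mu.-integrable D (EFin \o (fun t => k x t * f t)).
Proof.
move=> dk [mf f2] x0; have [mk [C C0 kC]] := dk.
have sx : 0 < Num.sqrt x by rewrite sqrtr_gt0.
pose w t := (Num.sqrt t)^-1 * (x + t)^-1.
have mw : measurable_fun D w.
  apply: measurable_funTS; apply: measurable_funM.
    exact: (measurableT_comp (@measurable_invr R) (@measurable_sqrtr R)).
  exact: (measurable_fun_pair2 x (@measurable_stieltjes R)).
have wE : (\int[mu]_(t in D) (w t)%:E = (pi / Num.sqrt x)%:E)%E.
  rewrite -integral_Rpos_sqrt_pole//; apply: eq_integral => t _.
  by rewrite /w sqr_sqrtr// ltW.
have iw : mu.-integrable D (EFin \o w).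
  apply/integrableP; split; first exact/measurable_EFinP.
  under eq_integral.
    move=> t; rewrite inE RposE => t0; rewrite gee0_abs; last first.
      by rewrite lee_fin mulr_ge0 ?invr_ge0 ?sqrtr_ge0// addr_ge0// ltW.
    over.
  by rewrite /= wE ltry.
have i2 : mu.-integrable D (EFin \o (fun t => f t ^+ 2)).
  apply/integrableP; split; first by apply/measurable_EFinP; exact: measurable_funX.
  by under eq_integral do rewrite gee0_abs ?lee_fin ?sqr_ge0//.
have ig : mu.-integrable D (EFin \o
    (fun t => C * (f t ^+ 2 + (Num.sqrt x)^-1 * w t))).
  apply: integrable_Rpos_scale.
  by refine (integrableD _ i2 (integrable_Rpos_scale (Num.sqrt x)^-1 iw)).
apply: le_integrable ig => //.
  by apply/measurable_EFinP; exact: dominated_measurable.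
move=> t; rewrite RposE => t0 /=.
have /andP[k0 k1] := kC _ _ x0 t0.
have st : 0 < Num.sqrt t by rewrite sqrtr_gt0.
have xt : 0 < x + t by rewrite addr_gt0.
rewrite lee_fin.
rewrite [leRHS]ger0_norm; last first.
  rewrite mulr_ge0// addr_ge0 ?sqr_ge0// !mulr_ge0 ?invr_ge0 ?ltW//.
rewrite normrM (ger0_norm k0) (le_trans (ler_wpM2r (normr_ge0 _) k1))//.
rewrite -mulrA ler_wpM2l// -[f t ^+ 2]real_normK ?num_real//.
have amgm : Num.sqrt x * Num.sqrt t <= x + t.
  have := sqr_ge0 (Num.sqrt x - Num.sqrt t).
  rewrite sqrrB !sqr_sqrtr ?(ltW x0) ?(ltW t0)//.
  by have := mulr_ge0 (ltW sx) (ltW st); lra.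
have b2 : (x + t)^-1 ^+ 2 <= (Num.sqrt x)^-1 * w t.
  rewrite /w expr2 mulrA ler_wpM2r ?invr_ge0 ?(ltW xt)// -invfM.
  by rewrite lef_pV2 ?posrE// mulr_gt0.
apply: le_trans (lerD (lexx _) b2).
by have := sqr_ge0 ((x + t)^-1 - `|f t|); have := sqr_ge0 ((x+t)^-1 + `|f t|); lra.
Qed.

Lemma kernel_op_lin k f g c x : stieltjes_dominated k -> L2real f -> L2real g ->
  0 < x -> kernel_op k (fun t => f t + c * g t) x = kernel_op k f x + c * kernel_op k g x.
Proof.
move=> dk Lf Lg x0; have i1 := dominated_integrable dk Lf x0.
have i2 := dominated_integrable dk Lg x0.
have i3 : mu.-integrable D (EFin \o (fun t => c * (k x t * g t))).
  exact: integrable_Rpos_scale.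
rewrite /kernel_op -RintegralZl// -RintegralD//.
by apply: eq_Rintegral => t _; ring.
Qed.

Lemma eq_kernel_op k f g x : (forall t, 0 < t -> f t = g t) ->
  kernel_op k f x = kernel_op k g x.
Proof.
by move=> fg; apply: eq_Rintegral => t; rewrite inE RposE => t0; rewrite fg.
Qed.

Lemma kernel_op_pos_neg k f x : stieltjes_dominated k -> L2real f -> 0 < x ->
  kernel_op k f x = kernel_op k f^\+ x + -1 * kernel_op k f^\- x.
Proof.
move=> dk Lf x0; rewrite -kernel_op_lin//; [|exact: L2real_funrpos|exact: L2real_funrneg].
apply: eq_kernel_op => t _; rewrite mulN1r -[in LHS](funrposBneg f).
by [].
Qed.

Lemma kernel_opE k f x : stieltjes_dominated k -> L2real f -> 0 < x ->
  ((kernel_op k f x)%:E = \int[mu]_(t in D) (k x t * f t)%:E)%E.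
Proof.
move=> dk Lf x0; rewrite fineK//.
by apply: integrable_fin_num => //; exact: dominated_integrable.
Qed.

Lemma kernel_op_ge0 k f x : stieltjes_dominated k -> (forall t, 0 < t -> 0 <= f t) ->
  0 < x -> 0 <= kernel_op k f x.
Proof.
move=> [_ [C _ kC]] f0 x0; apply: Rintegral_ge0 => t; rewrite RposE => t0.
by have /andP[? _] := kC _ _ x0 t0; rewrite mulr_ge0// f0.
Qed.

(** Integrate w (phi - c)^2 >= 0 with the optimal constant c = B / A. *)
Lemma weighted_cauchy_schwarz (w phi : R -> R) (A B : R) :
  measurable_fun D w -> measurable_fun D phi ->
  (forall t, 0 < t -> 0 <= w t) -> (forall t, 0 < t -> 0 <= phi t) -> 0 < A ->
  (\int[mu]_(t in D) (w t)%:E = A%:E)%E ->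
  (\int[mu]_(t in D) (w t * phi t)%:E = B%:E)%E ->
  ((B ^+ 2)%:E <= A%:E * \int[mu]_(t in D) (w t * phi t ^+ 2)%:E)%E.
Proof.
move=> mw mphi w0 phi0 A0 wA wB.
have B0 : 0 <= B.
  rewrite -lee_fin -wB; apply: integral_ge0 => t; rewrite RposE => t0.
  by rewrite lee_fin mulr_ge0 ?w0 ?phi0.
pose c := B / A; have c0 : 0 <= c by rewrite divr_ge0// ltW.
have c20 : 0 <= 2 * c by rewrite mulr_ge0.
have mw1 : measurable_fun D (fun t => (w t)%:E) by exact/measurable_EFinP.
have mwp : measurable_fun D (fun t => (w t * phi t)%:E).
  by apply/measurable_EFinP; exact: measurable_funM.
have mwp2 : measurable_fun D (fun t => (w t * phi t ^+ 2)%:E).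
  by apply/measurable_EFinP; apply: measurable_funM => //; exact: measurable_funX.
have le : ((2 * c * B)%:E <=
    \int[mu]_(t in D) (w t * phi t ^+ 2)%:E + (c ^+ 2 * A)%:E)%E.
  have -> : (2 * c * B)%:E = (\int[mu]_(t in D) ((2 * c)%:E * (w t * phi t)%:E))%E.
    rewrite ge0_integralZl_EFin ?wB// => t; rewrite RposE => t0.
    by rewrite lee_fin mulr_ge0 ?w0 ?phi0.
  have -> : (c ^+ 2 * A)%:E = (\int[mu]_(t in D) ((c ^+ 2)%:E * (w t)%:E))%E.
    rewrite ge0_integralZl_EFin ?wA ?sqr_ge0// => t; rewrite RposE => t0.
    by rewrite lee_fin w0.
  rewrite -ge0_integralD//.
  - apply: ge0_le_integral => //.
    + move=> t; rewrite RposE => t0.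
      by rewrite -EFinM lee_fin mulr_ge0// mulr_ge0 ?w0 ?phi0.
    + exact: measurable_funeM.
    + by apply: emeasurable_funD => //; exact: measurable_funeM.
    + move=> t; rewrite RposE => t0; rewrite -!EFinM -EFinD lee_fin.
      by have := mulr_ge0 (w0 _ t0) (sqr_ge0 (phi t - c)); lra.
  - by move=> t; rewrite RposE => t0; rewrite lee_fin mulr_ge0 ?w0 ?sqr_ge0.
  - by move=> t; rewrite RposE => t0; rewrite -EFinM lee_fin mulr_ge0 ?w0 ?sqr_ge0.
  - exact: measurable_funeM.
have -> : B ^+ 2 = A * (2 * c * B - c ^+ 2 * A).
  by rewrite /c; field; rewrite gt_eqF.
by rewrite EFinM lee_pmul2l// EFinB leeBlDr.
Qed.

(** The Schur test. The kernel may be replaced by its bound; weighted Cauchy-Schwarz bounds the square of the integral of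
    h(t) / (x + t) by pi x^(-1/2) times the integral of t^(1/2) h(t)^2 / (x + t),
    and integrating this in x first gives pi^2 times the integral of h^2. *)
Lemma L2real_kernel_op_ge0 k h : stieltjes_dominated k -> L2real h ->
  (forall t, 0 < t -> 0 <= h t) -> L2real (kernel_op k h).
Proof.
move=> dk Lh h0; have [mh h2] := Lh; have [mk [C C0 kC]] := dk.
pose s (x t : R) := (x + t)^-1.
have ds : stieltjes_dominated s.
  split; first exact: measurable_stieltjes.
  exists 1 => // x t x0 t0; rewrite mul1r lexx andbT invr_ge0.
  by rewrite addr_ge0 ?ltW.
have mop k' : stieltjes_dominated k' -> measurable_fun D (kernel_op k' h).
  move=> dk'; apply: (@measurableT_comp _ _ _ _ _ _ fine) => //.
  apply: (@measurable_integral_Rpos_l _ (fun x t => k' x t * h t)).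
    exact: dominated_measurable2.
  move=> x t x0 t0; have [_ [C' _ kC']] := dk'.
  by have /andP[? _] := kC' _ _ x0 t0; rewrite mulr_ge0 ?h0.
apply: (@L2real_dominated _ (kernel_op s h) (C ^+ 2)).
- exact: sqr_ge0.
- exact: mop.
- split; first exact: mop.
  pose G x t := pi * ((Num.sqrt x)^-1 * (x + t)^-1) * (Num.sqrt t * h t ^+ 2).
  have mG : measurable_fun (D `*` D) (fun p => G p.1 p.2).
    apply: measurable_funM.
      apply: measurable_funTS; apply: measurable_funM => //.
      apply: measurable_funM; last exact: measurable_stieltjes.
      apply: (measurableT_comp (@measurable_invr R)).
      by apply: (measurableT_comp (@measurable_sqrtr R)); exact: measurable_fst.
    have m2 : measurable_fun D (fun t => Num.sqrt t * h t ^+ 2).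
      apply: measurable_funM; last exact: measurable_funX.
      by apply: measurable_funTS; exact: measurable_sqrtr.
    apply: (measurable_comp (F := D)) m2 _ => //.
      by move=> _ [[x t] [_ ?] <-].
    by apply: measurable_funTS; exact: measurable_snd.
  have G0 x t : 0 < x -> 0 < t -> 0 <= G x t.
    move=> x0 t0; rewrite !mulr_ge0 ?pi_ge0 ?invr_ge0 ?sqrtr_ge0 ?h0//.
    by rewrite addr_ge0 ?ltW.
  have le : (\int[mu]_(x in D) (kernel_op s h x ^+ 2)%:E <=
      \int[mu]_(x in D) \int[mu]_(t in D) (G x t)%:E)%E.
    apply: ge0_le_integral => //.
    - by move=> x _; rewrite lee_fin sqr_ge0.
    - by apply/measurable_EFinP; apply: measurable_funX; exact: mop.
    - exact: measurable_integral_Rpos_l.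
    move=> x; rewrite RposE => x0.
    have sx : 0 < Num.sqrt x by rewrite sqrtr_gt0.
    have piA : 0 < pi / Num.sqrt x by rewrite divr_gt0// pi_gt0.
    pose w t := (Num.sqrt t)^-1 * (x + t)^-1.
    have w0 t : 0 < t -> 0 <= w t.
      by move=> t0; rewrite mulr_ge0 ?invr_ge0 ?sqrtr_ge0// addr_ge0 ?ltW.
    have mw : measurable_fun D w.
      apply: measurable_funTS; apply: measurable_funM.
        exact: (measurableT_comp (@measurable_invr R) (@measurable_sqrtr R)).
      exact: (measurable_fun_pair2 x (@measurable_stieltjes R)).
    have mphi : measurable_fun D (fun t => Num.sqrt t * h t).
      by apply: measurable_funM => //; apply: measurable_funTS; exact: measurable_sqrtr.
    have := @weighted_cauchy_schwarz w (fun t => Num.sqrt t * h t)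
      (pi / Num.sqrt x) (kernel_op s h x) mw mphi w0.
    move=> /(_ _ piA _ _)/le_trans; apply.
    - by move=> t t0; rewrite mulr_ge0 ?sqrtr_ge0 ?h0.
    - rewrite -integral_Rpos_sqrt_pole//; apply: eq_integral => t _.
      by rewrite /w sqr_sqrtr// ltW.
    - rewrite kernel_opE//; apply: eq_integral => t; rewrite inE RposE => t0.
      have st : Num.sqrt t != 0 by rewrite gt_eqF// sqrtr_gt0.
      have xt : x + t != 0 by rewrite gt_eqF// addr_gt0.
      by rewrite /w /s; congr EFin; field; rewrite st xt.
    - have -> : (\int[mu]_(t in D) (G x t)%:E = \int[mu]_(t in D)
          ((pi / Num.sqrt x)%:E * (w t * (Num.sqrt t * h t) ^+ 2)%:E))%E.
        apply: eq_integral => t; rewrite inE RposE => t0.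
        have st : Num.sqrt t != 0 by rewrite gt_eqF// sqrtr_gt0.
        have xt : x + t != 0 by rewrite gt_eqF// addr_gt0.
        rewrite -EFinM /w /G; congr EFin; field.
        by rewrite st xt gt_eqF.
      rewrite ge0_integralZl_EFin ?(ltW piA)//.
      + by move=> t; rewrite RposE => t0; rewrite lee_fin mulr_ge0 ?w0 ?sqr_ge0.
      + apply/measurable_EFinP; apply: measurable_funM => //; exact: measurable_funX.
  apply: (le_lt_trans le); rewrite tonelli_Rpos//.
  have -> : (\int[mu]_(t in D) \int[mu]_(x in D) (G x t)%:E =
      \int[mu]_(t in D) ((pi ^+ 2)%:E * (h t ^+ 2)%:E))%E; last first.
    rewrite ge0_integralZl_EFin ?sqr_ge0//.
    - by rewrite lte_mul_pinfty// lee_fin sqr_ge0.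
    - by move=> t _; rewrite lee_fin sqr_ge0.
    - by apply/measurable_EFinP; exact: measurable_funX.
  apply: eq_integral => t; rewrite inE RposE => t0.
  have st : 0 < Num.sqrt t by rewrite sqrtr_gt0.
  under eq_integral do rewrite /G mulrAC EFinM.
  rewrite ge0_integralZl_EFin//.
  - under eq_integral do rewrite addrC -[X in (X + _)^-1](sqr_sqrtr (ltW t0)).
    rewrite integral_Rpos_sqrt_pole// -!EFinM; congr EFin.
    by field; rewrite gt_eqF.
  - move=> x; rewrite RposE => x0.
    by rewrite lee_fin mulr_ge0 ?invr_ge0 ?sqrtr_ge0// addr_ge0 ?ltW.
  - apply/measurable_EFinP; apply: measurable_funTS; apply: measurable_funM.
      exact: (measurableT_comp (@measurable_invr R) (@measurable_sqrtr R)).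
    exact: (measurable_fun_pair1 t (@measurable_stieltjes R)).
  - by rewrite !mulr_ge0 ?pi_ge0 ?sqrtr_ge0 ?h0.
- move=> x x0; rewrite -exprMn.
  rewrite ler_sqr ?nnegrE ?mulr_ge0// ?kernel_op_ge0//.
  rewrite -RintegralZl//; last exact: dominated_integrable.
  apply: le_Rintegral => //; first exact: dominated_integrable.
    apply: integrable_Rpos_scale; exact: dominated_integrable.
  move=> t; rewrite RposE => t0; rewrite mulrA ler_wpM2r ?h0//.
  by have /andP[] := kC _ _ x0 t0.
Qed.

Lemma L2real_eq f g : L2real f -> (forall x, 0 < x -> f x = g x) -> L2real g.
Proof.
move=> Lf fg; apply: (@L2real_dominated _ f 1) => //.
  case: Lf => mf _; apply: eq_measurable_fun mf => x; rewrite inE RposE.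
  exact: fg.
by move=> x x0; rewrite mul1r fg.
Qed.

Lemma L2real_kernel_op k f : stieltjes_dominated k -> L2real f ->
  L2real (kernel_op k f).
Proof.
move=> dk Lf.
have Lp : L2real (kernel_op k f^\+).
  by apply: L2real_kernel_op_ge0 => //; exact: L2real_funrpos.
have Ln : L2real (kernel_op k f^\-).
  by apply: L2real_kernel_op_ge0 => //; exact: L2real_funrneg.
apply: (L2real_eq (L2real_lin (-1) Lp Ln)) => x x0.
by rewrite [RHS]kernel_op_pos_neg.
Qed.

(** Off-diagonal knowledge of the composed kernel is enough, since it is only
    integrated; splitting f into positive and negative parts reduces the claim
    to Tonelli's theorem. *)
Lemma kernel_op_comp k1 k2 k f x :
  stieltjes_dominated k1 -> stieltjes_dominated k2 -> stieltjes_dominated k ->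
  (forall x t, 0 < x -> 0 < t -> x != t ->
     (\int[mu]_(s in D) (k1 x s * k2 s t)%:E = (k x t)%:E)%E) ->
  L2real f -> 0 < x -> kernel_op k1 (kernel_op k2 f) x = kernel_op k f x.
Proof.
move=> dk1 dk2 dk kE.
wlog : f / forall t, 0 < t -> 0 <= f t.
  move=> wl Lf x0.
  have Lp := L2real_funrpos Lf; have Ln := L2real_funrneg Lf.
  rewrite [RHS]kernel_op_pos_neg// -!wl//.
  rewrite -kernel_op_lin//; last 2 first.
  - exact: L2real_kernel_op.
  - exact: L2real_kernel_op.
  by apply: eq_kernel_op => s s0; rewrite kernel_op_pos_neg.
move=> f0 Lf x0; have [mf _] := Lf.
have [mk1 [C1 _ k1C]] := dk1; have [mk2 [C2 _ k2C]] := dk2.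
have [mk [C _ kC]] := dk.
apply: EFin_inj.
rewrite kernel_opE//; last exact: L2real_kernel_op.
rewrite kernel_opE//.
pose F s t := k1 x s * (k2 s t * f t).
have mF : measurable_fun (D `*` D) (fun p => F p.1 p.2).
  apply: measurable_funM; last exact: dominated_measurable2.
  apply: measurable_funTS; apply: (measurableT_comp (measurable_fun_pair2 x mk1)).
  exact: measurable_fst.
have F0 s t : 0 < s -> 0 < t -> 0 <= F s t.
  move=> s0 t0; have /andP[? _] := k1C _ _ x0 s0.
  by have /andP[? _] := k2C _ _ s0 t0; rewrite !mulr_ge0 ?f0.
transitivity (\int[mu]_(s in D) \int[mu]_(t in D) (F s t)%:E)%E.
  apply: eq_integral => s; rewrite inE RposE => s0.
  have /andP[k1s _] := k1C _ _ x0 s0.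
  rewrite EFinM kernel_opE// -ge0_integralZl_EFin//.
  - move=> t; rewrite RposE => t0; have /andP[? _] := k2C _ _ s0 t0.
    by rewrite lee_fin mulr_ge0 ?f0.
  - by apply/measurable_EFinP; exact: dominated_measurable.
rewrite tonelli_Rpos//.
apply: (@eq_integral_Rpos_countable _ _ _ [set x]).
- exact: finite_set_countable.
- exact: measurable_integral_Rpos_r.
- by apply/measurable_EFinP; exact: dominated_measurable.
- move=> t t0; apply: integral_ge0 => s; rewrite RposE => s0.
  by rewrite lee_fin F0.
- move=> t t0; have /andP[? _] := kC _ _ x0 t0.
  by rewrite lee_fin mulr_ge0 ?f0.
- move=> t t0 /= /eqP tx.
  rewrite EFinM -kE 1?eq_sym// muleC -ge0_integralZl_EFin ?f0//.
  + by apply: eq_integral => s _; rewrite -EFinM /F mulrA mulrC.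
  + move=> s; rewrite RposE => s0; have /andP[? _] := k1C _ _ x0 s0.
    by have /andP[? _] := k2C _ _ s0 t0; rewrite lee_fin mulr_ge0.
  + apply/measurable_EFinP; apply: measurable_funTS; apply: measurable_funM.
      exact: (measurable_fun_pair2 x mk1).
    exact: (measurable_fun_pair1 t mk2).
Qed.

Lemma ae_eq_kernel_op k f g x : stieltjes_dominated k -> L2real f -> L2real g ->
  ae_eq mu D f g -> 0 < x -> kernel_op k f x = kernel_op k g x.
Proof.
move=> dk [mf _] [mg _] fg x0; congr fine; apply: ae_eq_integral => //.
- by apply/measurable_EFinP; exact: dominated_measurable.
- by apply/measurable_EFinP; exact: dominated_measurable.
- by apply: filterS fg => t h Dt; rewrite h.
Qed.

Lemma kernel_op_scale k c f x : stieltjes_dominated k -> L2real f -> 0 < x ->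
  kernel_op (fun x t => c * k x t) f x = c * kernel_op k f x.
Proof.
move=> dk Lf x0; rewrite -RintegralZl//; last exact: dominated_integrable.
by apply: eq_Rintegral => t _; rewrite mulrA.
Qed.

Lemma kernel_op_sub k1 k2 f x : stieltjes_dominated k1 -> stieltjes_dominated k2 ->
  L2real f -> 0 < x ->
  kernel_op (fun x t => k1 x t - k2 x t) f x = kernel_op k1 f x - kernel_op k2 f x.
Proof.
move=> d1 d2 Lf x0; rewrite -RintegralB//; do ?exact: dominated_integrable.
by apply: eq_Rintegral => t _; rewrite mulrBl.
Qed.

End L2_kernels.

(** * The inversion formulas for real functions *)

Section real_inversion.
Variable R : realType.
Implicit Types (f g : R -> R) (x t : R).
Notation mu := (@lebesgue_measure R).
Notation D := (@Rpos R).

Definition stieltjes_kernel x t : R := 1 / pi * (x + t)^-1.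
Definition scaled_log_kernel x t : R := 2 / pi ^+ 2 * log_kernel x t.

Lemma scaled_log_kernel_ge0 x t : 0 < x -> 0 < t -> 0 <= scaled_log_kernel x t.
Proof. by move=> x0 t0; rewrite mulr_ge0 ?log_kernel_ge0// divr_ge0// sqr_ge0. Qed.

Lemma stieltjes_kernel_ge0 x t : 0 < x -> 0 < t -> 0 <= stieltjes_kernel x t.
Proof.
by move=> x0 t0; rewrite mulr_ge0 ?divr_ge0 ?pi_ge0// invr_ge0 addr_ge0 ?ltW.
Qed.

Lemma stieltjes_log_comp x t : 0 < x -> 0 < t -> x != t ->
  (\int[mu]_(s in D) (stieltjes_kernel x s * scaled_log_kernel s t)%:E =
   (stieltjes_kernel x t - scaled_log_kernel x t)%:E)%E.
Proof.
move=> x0 t0 xt; have pi0 : (pi : R) != 0 by rewrite gt_eqF// pi_gt0.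
transitivity (\int[mu]_(s in D)
   ((2 / pi ^+ 3)%:E * ((x + s)^-1 * log_kernel s t)%:E))%E.
  apply: eq_integral => s; rewrite inE RposE => s0; rewrite -EFinM; congr EFin.
  rewrite /stieltjes_kernel /scaled_log_kernel mulrACA; congr (_ * _).
  by move: (pi : R) pi0 => p p0; field.
rewrite ge0_integralZl_EFin//.
- rewrite integral_stieltjes_log_kernel// -EFinM; congr EFin.
  have xs : x + t != 0 by rewrite gt_eqF// addr_gt0.
  rewrite /stieltjes_kernel /scaled_log_kernel.
  by move: (pi : R) pi0 => p p0; field; rewrite p0 xs.
- move=> s; rewrite RposE => s0; rewrite lee_fin mulr_ge0 ?log_kernel_ge0//.
  by rewrite invr_ge0 addr_ge0 ?ltW.
- apply/measurable_EFinP; apply: measurable_funTS; apply: measurable_funM.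
    exact: (measurable_fun_pair2 x (@measurable_stieltjes R)).
  exact: (measurable_fun_pair1 t (@measurable_log_kernel R)).
- by rewrite divr_ge0// exprn_ge0// pi_ge0.
Qed.

(** Both kernels are symmetric, so this is the previous identity transposed. *)
Lemma log_stieltjes_comp x t : 0 < x -> 0 < t -> x != t ->
  (\int[mu]_(s in D) (scaled_log_kernel x s * stieltjes_kernel s t)%:E =
   (stieltjes_kernel x t - scaled_log_kernel x t)%:E)%E.
Proof.
move=> x0 t0 xt.
rewrite {1}/stieltjes_kernel {1}/scaled_log_kernel.
have -> : stieltjes_kernel x t - scaled_log_kernel x t =
          stieltjes_kernel t x - scaled_log_kernel t x.
  by rewrite /stieltjes_kernel /scaled_log_kernel addrC (addrC x) log_kernelC addrC.
rewrite -stieltjes_log_comp 1?eq_sym//; apply: eq_integral => s _.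
by rewrite /stieltjes_kernel /scaled_log_kernel (addrC s) (log_kernelC x) mulrC.
Qed.

(** The difference of the two kernels is the integral of a product of two
    nonnegative kernels. *)
Lemma scaled_log_kernel_le x t : 0 < x -> 0 < t ->
  scaled_log_kernel x t <= stieltjes_kernel x t.
Proof.
move=> x0 t0; have [->|xt] := eqVneq x t.
  rewrite /scaled_log_kernel /log_kernel !subrr mulr0 mul0r mulr0.
  exact: stieltjes_kernel_ge0.
rewrite -subr_ge0 -lee_fin -stieltjes_log_comp//; apply: integral_ge0 => s.
rewrite RposE => s0; rewrite lee_fin.
by rewrite mulr_ge0 ?stieltjes_kernel_ge0 ?scaled_log_kernel_ge0.
Qed.

Lemma measurable_scaled_log_kernel :
  measurable_fun [set: R * R] (fun p => scaled_log_kernel p.1 p.2).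
Proof. by apply: measurable_funM => //; exact: measurable_log_kernel. Qed.

Lemma measurable_stieltjes_kernel :
  measurable_fun [set: R * R] (fun p => stieltjes_kernel p.1 p.2).
Proof. by apply: measurable_funM => //; exact: measurable_stieltjes. Qed.

Lemma stieltjes_kernel_dominated : stieltjes_dominated stieltjes_kernel.
Proof.
split; first exact: measurable_stieltjes_kernel.
exists (1 / pi) => [|x t x0 t0]; first by rewrite divr_ge0 ?pi_ge0.
by rewrite stieltjes_kernel_ge0//= lexx.
Qed.

Lemma scaled_log_kernel_dominated : stieltjes_dominated scaled_log_kernel.
Proof.
split; first exact: measurable_scaled_log_kernel.
exists (1 / pi) => [|x t x0 t0]; first by rewrite divr_ge0 ?pi_ge0.
by rewrite scaled_log_kernel_ge0//=; exact: scaled_log_kernel_le.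
Qed.

Lemma kernel_difference_dominated :
  stieltjes_dominated (fun x t => stieltjes_kernel x t - scaled_log_kernel x t).
Proof.
split.
  apply: measurable_funB; first exact: measurable_stieltjes_kernel.
  exact: measurable_scaled_log_kernel.
exists (1 / pi) => [|x t x0 t0]; first by rewrite divr_ge0 ?pi_ge0.
rewrite subr_ge0 scaled_log_kernel_le//=.
by rewrite lerBlDr lerDl scaled_log_kernel_ge0.
Qed.

(** The explicit factors 1 and -1 give both operators the shape f + c g handled by
    [L2real_lin] and [kernel_op_lin]. *)
Definition real_stieltjes_op f x := f x + 1 * kernel_op stieltjes_kernel f x.
Definition real_log_op f x := f x + -1 * kernel_op scaled_log_kernel f x.

Let dS := stieltjes_kernel_dominated.
Let dK := scaled_log_kernel_dominated.

Lemma L2real_stieltjes_op f : L2real f -> L2real (real_stieltjes_op f).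
Proof. by move=> Lf; apply: L2real_lin => //; exact: L2real_kernel_op. Qed.

Lemma L2real_log_op f : L2real f -> L2real (real_log_op f).
Proof. by move=> Lf; apply: L2real_lin => //; exact: L2real_kernel_op. Qed.

(** (I + S)(I - K) = I + S - K - S K = I. *)
Lemma real_log_opK f x : L2real f -> 0 < x ->
  real_stieltjes_op (real_log_op f) x = f x.
Proof.
move=> Lf x0; rewrite /real_stieltjes_op kernel_op_lin//; last exact: L2real_kernel_op.
rewrite (kernel_op_comp dS dK kernel_difference_dominated)//.
  by rewrite kernel_op_sub// /real_log_op; ring.
by move=> ? ?; exact: stieltjes_log_comp.
Qed.

Lemma real_stieltjes_opK f x : L2real f -> 0 < x ->
  real_log_op (real_stieltjes_op f) x = f x.
Proof.
move=> Lf x0; rewrite /real_log_op kernel_op_lin//; last exact: L2real_kernel_op.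
rewrite (kernel_op_comp dK dS kernel_difference_dominated)//.
  by rewrite kernel_op_sub// /real_stieltjes_op; ring.
by move=> ? ?; exact: log_stieltjes_comp.
Qed.

End real_inversion.

(** * The inversion formulas for complex functions *)

Local Open Scope complex_scope.

Section complex_inversion.
Variable R : realType.
Implicit Types (f g : R -> R[i]) (x t : R).
Notation mu := (@lebesgue_measure R).
Notation D := (@Rpos R).
Notation Re f := (fun x => complex.Re (f x)).
Notation Im f := (fun x => complex.Im (f x)).

Lemma L2_RposP f : L2_Rpos f <-> L2real (Re f) /\ L2real (Im f).
Proof.
have normE z : Normc.normc z ^+ 2 = complex.Re z ^+ 2 + complex.Im z ^+ 2 :> R.
  by case: z => a b /=; rewrite sqr_sqrtr// addr_ge0// sqr_ge0.
have split_int : measurable_fun D (Re f) -> measurable_fun D (Im f) ->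
  (\int[mu]_(x in D) (Normc.normc (f x) ^+ 2)%:E =
   \int[mu]_(x in D) (complex.Re (f x) ^+ 2)%:E +
   \int[mu]_(x in D) (complex.Im (f x) ^+ 2)%:E)%E.
  move=> mr mi; under eq_integral do rewrite normE EFinD.
  rewrite ge0_integralD//.
  - by move=> x _; rewrite lee_fin sqr_ge0.
  - by apply/measurable_EFinP; exact: measurable_funX.
  - by move=> x _; rewrite lee_fin sqr_ge0.
  - by apply/measurable_EFinP; exact: measurable_funX.
have i0 (u : R -> R) : (0 <= \int[mu]_(x in D) (u x ^+ 2)%:E)%E.
  by apply: integral_ge0 => x _; rewrite lee_fin sqr_ge0.
split => [[mr mi]|[[mr r2] [mi i2]]].
  rewrite split_int// => lt; split; split => //; apply: le_lt_trans lt.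
    by rewrite leeDl.
  by rewrite leeDr.
by split => //; rewrite split_int// lte_add_pinfty.
Qed.

Lemma add_real_scale (z : R[i]) (c u v : R) :
  z + c%:C * (u +i* v) = (complex.Re z + c * u) +i* (complex.Im z + c * v).
Proof.
by case: z => a b; apply/eqP; rewrite eq_complex /=; apply/andP; split;
  apply/eqP; ring.
Qed.

Lemma Re_scale (z : R[i]) (r : R) : complex.Re (r%:C * z) = r * complex.Re z.
Proof. by case: z => a b /=; rewrite mul0r subr0. Qed.

Lemma Im_scale (z : R[i]) (r : R) : complex.Im (r%:C * z) = r * complex.Im z.
Proof. by case: z => a b /=; rewrite mul0r addr0. Qed.

Lemma Cintegral_real_scale (k : R -> R) f :
  Cintegral_Rpos (fun t => (k t)%:C * f t) =
  (\int[mu]_(t in D) (k t * complex.Re (f t))) +i*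
  (\int[mu]_(t in D) (k t * complex.Im (f t))).
Proof.
by congr (_ +i* _); apply: eq_Rintegral => t _; rewrite ?Re_scale ?Im_scale.
Qed.

Lemma kernel_op_unscale (k : R -> R -> R) (c : R) (u : R -> R) x : c != 0 ->
  stieltjes_dominated (fun x t => c * k x t) -> L2real u -> 0 < x ->
  c * (\int[mu]_(t in D) (k x t * u t)) = kernel_op (fun x t => c * k x t) u x.
Proof.
move=> c0 dk Lu x0; rewrite -[RHS](mulKf (invr_neq0 c0)) invrK; congr (_ * _).
rewrite -kernel_op_scale//; apply: eq_Rintegral => t _.
by rewrite mulKf.
Qed.

Lemma stieltjes_opE f x : L2_Rpos f -> 0 < x ->
  stieltjes_op f x = real_stieltjes_op (Re f) x +i* real_stieltjes_op (Im f) x.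
Proof.
move=> /L2_RposP[Lr Li] x0.
have pi0 : (1 / pi : R) != 0 by rewrite gt_eqF// divr_gt0// pi_gt0.
have E : (fun t => f t / (x + t)%:C) = (fun t => ((x + t)^-1)%:C * f t).
  by apply/funext => t; rewrite mulrC -fmorphV.
rewrite /stieltjes_op E Cintegral_real_scale add_real_scale.
have opE u Lu := @kernel_op_unscale (fun x t => (x + t)^-1) _ u x pi0
  (@stieltjes_kernel_dominated R) Lu x0.
have /= opr := opE _ Lr; have /= opi := opE _ Li.
by rewrite /real_stieltjes_op !(mul1r (kernel_op _ _ _)) opr opi.
Qed.

Lemma log_opE g x : L2_Rpos g -> 0 < x ->
  log_op g x = real_log_op (Re g) x +i* real_log_op (Im g) x.
Proof.
move=> /L2_RposP[Lr Li] x0.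
have pi0 : (2 / pi ^+ 2 : R) != 0 by rewrite gt_eqF// divr_gt0// exprn_gt0// pi_gt0.
rewrite /log_op Cintegral_real_scale -mulNr -rmorphN add_real_scale.
have opE u Lu := @kernel_op_unscale (@log_kernel R) _ u x pi0
  (@scaled_log_kernel_dominated R) Lu x0.
have /= opr := opE _ Lr; have /= opi := opE _ Li.
by rewrite /real_log_op !mulN1r !mulNr opr opi.
Qed.

Lemma L2_stieltjes_op f : L2_Rpos f -> L2_Rpos (stieltjes_op f).
Proof.
move=> Lf; have /L2_RposP[Lr Li] := Lf; apply/L2_RposP; split.
- apply: L2real_eq (L2real_stieltjes_op Lr) _ => x x0.
  by rewrite stieltjes_opE.
- apply: L2real_eq (L2real_stieltjes_op Li) _ => x x0.
  by rewrite stieltjes_opE.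
Qed.

Lemma L2_log_op g : L2_Rpos g -> L2_Rpos (log_op g).
Proof.
move=> Lg; have /L2_RposP[Lr Li] := Lg; apply/L2_RposP; split.
- by apply: L2real_eq (L2real_log_op Lr) _ => x x0; rewrite log_opE.
- by apply: L2real_eq (L2real_log_op Li) _ => x x0; rewrite log_opE.
Qed.

Lemma eq_real_stieltjes_op (u v : R -> R) x : (forall t, 0 < t -> u t = v t) ->
  0 < x -> real_stieltjes_op u x = real_stieltjes_op v x.
Proof. by move=> uv x0; rewrite /real_stieltjes_op (eq_kernel_op _ _ uv) uv. Qed.

Lemma eq_real_log_op (u v : R -> R) x : (forall t, 0 < t -> u t = v t) ->
  0 < x -> real_log_op u x = real_log_op v x.
Proof. by move=> uv x0; rewrite /real_log_op (eq_kernel_op _ _ uv) uv. Qed.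

Lemma log_opK g x : L2_Rpos g -> 0 < x -> stieltjes_op (log_op g) x = g x.
Proof.
move=> Lg x0; have /L2_RposP[Lr Li] := Lg.
rewrite stieltjes_opE//; last exact: L2_log_op.
rewrite (@eq_real_stieltjes_op _ (real_log_op (Re g)))//; last first.
  by move=> t t0; rewrite log_opE.
rewrite (@eq_real_stieltjes_op (Im (log_op g)) (real_log_op (Im g)))//; last first.
  by move=> t t0; rewrite log_opE.
by rewrite !real_log_opK//; case: (g x).
Qed.

Lemma stieltjes_opK f x : L2_Rpos f -> 0 < x -> log_op (stieltjes_op f) x = f x.
Proof.
move=> Lf x0; have /L2_RposP[Lr Li] := Lf.
rewrite log_opE//; last exact: L2_stieltjes_op.
rewrite (@eq_real_log_op _ (real_stieltjes_op (Re f)))//; last first.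
  by move=> t t0; rewrite stieltjes_opE.
rewrite (@eq_real_log_op (Im (stieltjes_op f)) (real_stieltjes_op (Im f)))//; last first.
  by move=> t t0; rewrite stieltjes_opE.
by rewrite !real_stieltjes_opK//; case: (f x).
Qed.

Lemma ae_eq_Re_Im f g : ae_eq_Rpos f g ->
  ae_eq mu D (Re f) (Re g) /\ ae_eq mu D (Im f) (Im g).
Proof. by move=> fg; split; apply: filterS fg => x h Dx; rewrite h. Qed.

Lemma ae_eq_stieltjes_op f g : L2_Rpos f -> L2_Rpos g -> ae_eq_Rpos f g ->
  ae_eq_Rpos (stieltjes_op f) (stieltjes_op g).
Proof.
move=> Lf Lg fg; have [fr fi] := ae_eq_Re_Im fg.
have /L2_RposP[Lfr Lfi] := Lf; have /L2_RposP[Lgr Lgi] := Lg.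
have dS := @stieltjes_kernel_dominated R.
apply: filterS fg => x fgx Dx; have x0 : 0 < x by move: Dx; rewrite RposE.
rewrite !stieltjes_opE// /real_stieltjes_op fgx//.
by rewrite (ae_eq_kernel_op dS Lfr Lgr fr)// (ae_eq_kernel_op dS Lfi Lgi fi).
Qed.

Lemma ae_eq_log_op f g : L2_Rpos f -> L2_Rpos g -> ae_eq_Rpos f g ->
  ae_eq_Rpos (log_op f) (log_op g).
Proof.
move=> Lf Lg fg; have [fr fi] := ae_eq_Re_Im fg.
have /L2_RposP[Lfr Lfi] := Lf; have /L2_RposP[Lgr Lgi] := Lg.
have dK := @scaled_log_kernel_dominated R.
apply: filterS fg => x fgx Dx; have x0 : 0 < x by move: Dx; rewrite RposE.
rewrite !log_opE// /real_log_op fgx//.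
by rewrite (ae_eq_kernel_op dK Lfr Lgr fr)// (ae_eq_kernel_op dK Lfi Lgi fi).
Qed.

Lemma eq_ae_eq_Rpos f g : (forall x, 0 < x -> f x = g x) -> ae_eq_Rpos f g.
Proof. by move=> fg; apply: aeW => x; rewrite RposE; exact: fg. Qed.

End complex_inversion.

Theorem corollary1 (R : realType) :
  (forall g : R -> R[i], L2_Rpos g ->
     exists f : R -> R[i],
       [/\ L2_Rpos f,
           ae_eq_Rpos (stieltjes_op f) g,
           (forall h : R -> R[i], L2_Rpos h ->
              ae_eq_Rpos (stieltjes_op h) g -> ae_eq_Rpos h f) &
           ae_eq_Rpos f (log_op g)])
  /\
  (forall f : R -> R[i], L2_Rpos f ->
     exists g : R -> R[i],
       [/\ L2_Rpos g,
           ae_eq_Rpos f (log_op g),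
           (forall h : R -> R[i], L2_Rpos h ->
              ae_eq_Rpos f (log_op h) -> ae_eq_Rpos h g) &
           ae_eq_Rpos (stieltjes_op f) g]).
Proof.
split => [g Lg|f Lf].
- exists (log_op g); split.
  + exact: L2_log_op.
  + by apply: eq_ae_eq_Rpos => x; exact: log_opK.
  + move=> h Lh /(ae_eq_log_op (L2_stieltjes_op Lh) Lg); apply: ae_eq_trans.
    by apply: eq_ae_eq_Rpos => x x0; rewrite stieltjes_opK.
  + exact: ae_eq_refl.
- exists (stieltjes_op f); split.
  + exact: L2_stieltjes_op.
  + by apply: eq_ae_eq_Rpos => x x0; rewrite stieltjes_opK.
  + move=> h Lh /(ae_eq_stieltjes_op Lf (L2_log_op Lh)) /ae_eq_sym.
    apply: ae_eq_trans.
    by apply: eq_ae_eq_Rpos => x x0; rewrite log_opK.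
  + exact: ae_eq_refl.
Qed.
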